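(* For the online conversion problem with switching costs (in either its minimization variant OCS-min or its maximization variant OCS-max), any learning-augmented online algorithm whose only advice is a prediction of the ''best price'' of the input sequence cannot be 1-consistent, regardless of its robustness.
   Context: OCS-min: known horizon $T$, rate constraints $d_t\in(0,1]$, constants $0<L<U$, switching cost coefficient $\beta\in(0,(U-L)/2)$; an instance is a sequence of convex cost functions $g_t:[0,1]\to\mathbb{R}_{\ge0}$, $g_t(0)=0$, $L\le g_t'\le U$, revealed online; the player chooses irrevocably $x_t\in[0,d_t]$ with $\sum_t x_t=1$, and with $x_0=x_{T+1}=0$ pays $\sum_t g_t(x_t)+\beta\sum_{t=1}^{T+1}|x_t-x_{t-1}|$. OCS-max is the same except that the $g_t$ are concave price functions (with $g_t(0)=0$, $g_t\ge 0$, $L\le g_t'\le U$), $\beta\in(0,L/2)$, and the player maximizes $\sum_t g_t(x_t)-\beta\sum_{t=1}^{T+1}|x_t-x_{t-1}|$. Competitive ratio: $\sup_{\mathcal I}\mathrm{ALG}/\mathrm{OPT}$ for OCS-min and $\sup_{\mathcal I}\mathrm{OPT}/\mathrm{ALG}$ for OCS-max. A ''best price'' prediction is a single value $\hat P\in[L,U]$ given to the algorithm before the sequence, predicting the best input of the sequence (for linear functions $g_t(y)=c_ty$, the minimum coefficient $c_t$ in OCS-min, the maximum in OCS-max). The algorithm is $\eta$-consistent if its competitive ratio over instances for which the prediction is correct is at most $\eta$, and $\gamma$-robust if its competitive ratio is at most $\gamma$ for arbitrary predictions. *)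

(* Defs.v *)
From HB Require Import structures.
From mathcomp Require Import all_boot all_order all_algebra.
From mathcomp Require Import all_classical all_reals all_analysis.

Set Implicit Arguments.
Unset Strict Implicit.
Unset Printing Implicit Defensive.

Import Order.TTheory GRing.Theory Num.Theory.
Import numFieldNormedType.Exports.

Local Open Scope classical_set_scope.
Local Open Scope ring_scope.

Variant ocs_variant := OCSmin | OCSmax.

(* Time step t of {1, ..., T} is the ordinal t - 1 of 'I_T.  A cost/price
   function on [0, 1] is a total function R -> R; only its restriction to
   [0, 1] is ever constrained, priced or revealed. *)
Record ocs_instance (R : realType) := OCSInstance {
  horizon : nat ;
  rate : 'I_horizon -> R ;
  price : 'I_horizon -> R -> R
}.
Arguments rate {R} o _.
Arguments price {R} o _ _.

Definition switching_range (R : realType) (v : ocs_variant) (L U beta : R) :=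
  match v with
  | OCSmin => 0 < beta < (U - L) / 2
  | OCSmax => 0 < beta < L / 2
  end.

(* Given convexity (or concavity), differentiability inside the interval with
   L <= g' <= U together with continuity at 0 and 1 is the same as having, in
   addition, one-sided derivatives in [L, U] at the two endpoints. *)
Definition valid_price (R : realType) (v : ocs_variant) (L U : R)
    (g : R -> R) : Prop :=
  [/\ match v with
      | OCSmin => convex_function (`[0, 1]%classic : set R^o) (g : R -> R^o)
      | OCSmax =>
          convex_function (`[0, 1]%classic : set R^o) ((\- g) : R -> R^o)
      end,
      g 0 = 0,
      forall y : R, 0 <= y <= 1 -> 0 <= g y,
      derivable_oo_LRcontinuous (g : R -> R^o) 0 1 &
      forall y : R, 0 < y < 1 -> L <= derive1 (g : R -> R^o) y <= U].

(* The condition 1 <= \sum_t d_t says that a feasible decision exists; it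
   forces T >= 1. *)
Definition valid_instance (R : realType) (v : ocs_variant) (L U : R)
    (I : ocs_instance R) : Prop :=
  [/\ forall t, 0 < rate I t <= 1,
      1 <= \sum_t rate I t &
      forall t, valid_price v L U (price I t)].

Definition feasible (R : realType) (I : ocs_instance R)
    (x : 'I_(horizon I) -> R) : Prop :=
  (forall t, 0 <= x t <= rate I t) /\ \sum_t x t = 1.

(* x_t with the 1-based index t, extended by x_0 = 0 and x_t = 0 for t > T. *)
Definition padded (R : realType) (T : nat) (x : 'I_T -> R) (t : nat) : R :=
  if t is s.+1 then oapp x 0 (insub s) else 0.

Definition switching (R : realType) (T : nat) (x : 'I_T -> R) : R :=
  \sum_(1 <= t < T.+2) `|padded x t - padded x t.-1|.

Definition objective (R : realType) (v : ocs_variant) (beta : R)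
    (I : ocs_instance R) (x : 'I_(horizon I) -> R) : R :=
  match v with
  | OCSmin => \sum_t price I t (x t) + beta * switching x
  | OCSmax => \sum_t price I t (x t) - beta * switching x
  end.

Definition opt (R : realType) (v : ocs_variant) (beta : R)
    (I : ocs_instance R) : R :=
  match v with
  | OCSmin => inf [set objective v beta x | x in @feasible R I]
  | OCSmax => sup [set objective v beta x | x in @feasible R I]
  end.

(* [A I P t] is the decision made at step t on instance I with prediction P. *)
Definition algorithm (R : realType) :=
  forall I : ocs_instance R, R -> 'I_(horizon I) -> R.

(* The horizon and the rate constraints are known from the start, while only
   the functions of steps 1, ..., t have been revealed at step t: the second
   clause says that the decision depends on nothing else. *)
Definition online_algorithm (R : realType) (v : ocs_variant) (L U : R)
    (A : algorithm R) : Prop :=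
  (forall I P, valid_instance v L U I -> L <= P <= U -> feasible (A I P)) /\
  (forall T (d : 'I_T -> R) (g h : 'I_T -> R -> R) P (t : 'I_T),
     valid_instance v L U (OCSInstance d g) ->
     valid_instance v L U (OCSInstance d h) ->
     L <= P <= U ->
     (forall s : 'I_T, (s <= t)%N ->
        forall y, 0 <= y <= 1 -> g s y = h s y) ->
     A (OCSInstance d g) P t = A (OCSInstance d h) P t).

(* On valid instances no division by 0 occurs: in OCSmin, OPT >= L > 0; in
   OCSmax, ALG >= L - 2 * beta > 0. *)
Definition performance_ratio (R : realType) (v : ocs_variant) (beta : R)
    (A : algorithm R) (I : ocs_instance R) (P : R) : R :=
  match v with
  | OCSmin => objective v beta (A I P) / opt v beta I
  | OCSmax => opt v beta I / objective v beta (A I P)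
  end.

Definition competitive_ratio (R : realType) (v : ocs_variant) (beta : R)
    (A : algorithm R) (S : set (ocs_instance R * R)) : \bar R :=
  ereal_sup [set (performance_ratio v beta A IP.1 IP.2)%:E | IP in S].

(* [best] assigns to an instance its best price.  It is prescribed on
   instances made of linear functions and arbitrary on the others. *)
Definition best_price (R : realType) (v : ocs_variant) (L U : R)
    (best : ocs_instance R -> R) : Prop :=
  forall (I : ocs_instance R) (c : 'I_(horizon I) -> R),
    valid_instance v L U I ->
    (forall t y, 0 <= y <= 1 -> price I t y = c t * y) ->
    (exists t, best I = c t) /\
    (forall t, match v with
               | OCSmin => best I <= c t
               | OCSmax => c t <= best I
               end).

Definition consistent (R : realType) (v : ocs_variant) (L U beta : R)
    (best : ocs_instance R -> R) (A : algorithm R) (eta : \bar R) : Prop :=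
  let correct := [set IP : ocs_instance R * R |
    [/\ valid_instance v L U IP.1, L <= IP.2 <= U & IP.2 = best IP.1]] in
  (competitive_ratio v beta A correct <= eta)%E.

Definition robust (R : realType) (v : ocs_variant) (L U beta : R)
    (A : algorithm R) (gamma : \bar R) : Prop :=
  let arbitrary := [set IP : ocs_instance R * R |
    valid_instance v L U IP.1 /\ L <= IP.2 <= U] in
  (competitive_ratio v beta A arbitrary <= gamma)%E.

(* Main.v *)
Require Import Defs.
From HB Require Import structures.
From mathcomp Require Import all_boot all_order all_algebra.
From mathcomp Require Import all_classical all_reals all_analysis.
From mathcomp Require Import lra.
Set Implicit Arguments.
Unset Strict Implicit.
Unset Printing Implicit Defensive.

Import Order.TTheory GRing.Theory Num.Theory.
Import numFieldNormedType.Exports.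
Local Open Scope ring_scope.

(** Three steps with rates 1, 1/4, 1 and linear prices p, e, c, where e is the
    best possible price, p = (L + U) / 2, and c is either e or the worst
    possible price w.  The best price is e in both cases.  A decision (x, y, z)
    has switching cost at least 2 (x + z - y) = 2 (1 - 2 y) >= 1, and
    (1/4, 1/4, 1/2) and (1/2, 1/4, 1/4) attain the bound 1.  Hence x <= 1/4 in
    every optimum if c = e, whereas z <= 1/4, so x >= 1/2, in every optimum if
    c = w.  The first decision, made before c is revealed, cannot be optimal for
    both. *)

Lemma linear_valid_price (R : realType) (v : ocs_variant) (L U c : R) :
  0 < L -> L <= c <= U -> valid_price v L U (fun y => c * y).
Proof.
move=> L0 /andP[Lc cU].
have dc (y r : R) : derivable ( *%R r : R -> R) y 1.
  by apply: derivableM => //; exact: derivable_id.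
have cc (r : R) : continuous ( *%R r : R -> R).
  exact: mulrl_continuous.
split.
(* For a linear function the convexity inequality is an equality, so it serves the function and its
   opposite alike. *)
- have lin (t : {i01 R}) (x y : R^o) :
      c * conv t x y = t%:num * (c * x) + unstable.onem t%:num * (c * y).
    by rewrite convRE mulrDr !(mulrCA c).
  by case: v => t x y _ _ /=; rewrite !convRE /= (lin t x y) ?opprD -?mulrN.
- by rewrite mulr0.
- by move=> y /andP[y0 _]; rewrite mulr_ge0// (le_trans (ltW L0)).
- split.
  + by move=> y _; exact: dc.
  + by apply: cvg_at_right_filter; exact: cc.
  + by apply: cvg_at_left_filter; exact: cc.
- move=> y _; rewrite derive1Ml; last exact: derivable_id.
  by rewrite derive1_id mulr1 Lc.
Qed.

(** The bound [m > 0] makes the denominator positive, so the ratio can be cleared. The bounds [m]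
    for [inf] and [M] for [sup] make [opt] a true bound on every feasible objective value. *)
Lemma performance_ratio_le1_optimal (R : realType) (v : ocs_variant) (beta : R)
    (A : algorithm R) (I : ocs_instance R) (P m M : R)
    (x : 'I_(horizon I) -> R) :
  0 < m -> (forall y, @feasible R I y -> m <= @objective R v beta I y <= M) ->
  feasible (A I P) -> feasible x -> performance_ratio v beta A I P <= 1 ->
  match v with
  | OCSmin => objective v beta (A I P) <= @objective R v beta I x
  | OCSmax => @objective R v beta I x <= objective v beta (A I P)
  end.
Proof.
move=> m0 bnd fA fx; rewrite /performance_ratio /opt; case: v bnd => bnd.
- have mi : m <= inf [set @objective R OCSmin beta I y | y in @feasible R I]%classic.
    apply: lb_le_inf; first by exists (@objective R OCSmin beta I x), x.
    by move=> _ [y fy <-]; case/andP: (bnd _ fy).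
  rewrite ler_pdivrMr ?mul1r; last exact: lt_le_trans mi.
  move=> /le_trans; apply; apply: ge_inf; last by exists x.
  by exists m => _ [y fy <-]; case/andP: (bnd _ fy).
- rewrite ler_pdivrMr ?mul1r; last first.
    by apply: lt_le_trans m0 _; case/andP: (bnd _ fA).
  apply: le_trans; apply: ub_le_sup; last by exists x.
  by exists M => _ [y fy <-]; case/andP: (bnd _ fy).
Qed.

Definition three_steps (R : realType) (p e c : R) : ocs_instance R :=
  @OCSInstance R 3 (fun t => [:: 1; 4^-1; 1]`_t) (fun t y => [:: p; e; c]`_t * y).

Definition decision3 (R : realType) (x y z : R) (t : 'I_3) : R := [:: x; y; z]`_t.

Lemma decision3_surj (R : realType) (f : 'I_3 -> R) :
  exists x y z, f = decision3 x y z.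
Proof.
exists (f ord0), (f (lift ord0 ord0)), (f (lift ord0 (lift ord0 ord0))).
by apply/funext => -[[|[|[|//]]] i]; rewrite /decision3 /=; congr f; exact/val_inj.
Qed.

Lemma switching3E (R : realType) (x y z : R) :
  switching (decision3 x y z) = `|x| + `|y - x| + `|z - y| + `|z|.
Proof.
rewrite /switching /index_iota /= !big_cons big_nil /padded /=.
(* Steps 1 to 3 lie in ['I_3]; step 4 does not and takes the default 0, which yields the closing
   term [|z|]. *)
rewrite insubT insubT insubT insubF //= subr0 sub0r normrN addr0 !addrA //.
Qed.

Section three_steps.
Context (R : realType).
Implicit Types (v : ocs_variant) (x y z p e c L U beta : R).

Lemma three_steps_objectiveE v beta p e c x y z :
  @objective R v beta (three_steps p e c) (decision3 x y z) =
  let sw := `|x| + `|y - x| + `|z - y| + `|z| in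
  let s := p * x + e * y + c * z in
  match v with OCSmin => s + beta * sw | OCSmax => s - beta * sw end.
Proof.
by rewrite /objective switching3E; case: v;
  rewrite /= !big_ord_recl big_ord0 addr0 addrA.
Qed.

Lemma three_steps_feasible p e c x y z :
  @feasible R (three_steps p e c) (decision3 x y z) <->
  [/\ 0 <= x <= 1, 0 <= y <= 4^-1, 0 <= z <= 1 & x + y + z = 1].
Proof.
rewrite /feasible /= !big_ord_recl big_ord0 addr0 addrA /decision3 /=.
split=> [[dx s1]|[dx dy dz s1]].
  split=> //; [exact: (dx ord0)|exact: (dx (lift ord0 ord0))|].
  exact: (dx (lift ord0 (lift ord0 ord0))).
by split=> // -[[|[|[|//]]] i].
Qed.

Lemma three_steps_switching_ge1 x y z : 0 <= y <= 4^-1 -> x + y + z = 1 ->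
  1 <= `|x| + `|y - x| + `|z - y| + `|z|.
Proof.
move=> hy s1.
have := ler_norm x; have := ler_norm z; have := ler_norm (z - y).
by rewrite (distrC y x); have := ler_norm (x - y); lra.
Qed.

Lemma three_steps_valid v L U p e c : 0 < L ->
  L <= p <= U -> L <= e <= U -> L <= c <= U ->
  valid_instance v L U (three_steps p e c).
Proof.
move=> L0 hp he hc; split.
- by move=> -[[|[|[|//]]] i] /=; lra.
- by rewrite /= !big_ord_recl big_ord0 /=; lra.
- by move=> -[[|[|[|//]]] i] /=; exact: linear_valid_price.
Qed.

(** The linear part is an average of prices in [L, U] with weights [x], [y], [z], and the triangle
    inequality bounds the switching by 2 (x + y + z) = 2. The lower bound is positive because
    [beta < L / 2] in OCSmax. *)
Lemma three_steps_objective_bounds v L U beta p e c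
    (w : 'I_(horizon (three_steps p e c)) -> R) :
  switching_range v L U beta -> 0 < L ->
  L <= p <= U -> L <= e <= U -> L <= c <= U -> @feasible R (three_steps p e c) w ->
  match v with OCSmin => L | OCSmax => L - 2 * beta end
    <= @objective R v beta (three_steps p e c) w <= U + 2 * beta.
Proof.
move=> hb L0 hp he hc; have [x [y [z ->]]] := decision3_surj w.
move=> /three_steps_feasible[hx hy hz s1]; rewrite three_steps_objectiveE /=.
have sw0 : 0 <= `|x| + `|y - x| + `|z - y| + `|z| by rewrite !addr_ge0.
have sw2 : `|x| + `|y - x| + `|z - y| + `|z| <= 2.
  have := ler_normB y x; have := ler_normB z y.
  by rewrite (ger0_norm (_ : 0 <= x)) ?(ger0_norm (_ : 0 <= y))
    ?(ger0_norm (_ : 0 <= z)); lra.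
move: (`|x| + _ + _ + _) sw0 sw2 => sw sw0 sw2.
have lo : L <= p * x + e * y + c * z by nra.
have hi : p * x + e * y + c * z <= U by nra.
by case: v hb => /= hb; apply/andP; split; nra.
Qed.

End three_steps.

Theorem theorem3 (R : realType) (v : ocs_variant) (L U beta : R)
    (hL : 0 < L) (hLU : L < U) (hbeta : switching_range v L U beta)
    (best : ocs_instance R -> R) (hbest : best_price v L U best)
    (A : algorithm R) (hA : online_algorithm v L U A)
    (gamma : \bar R) (hgamma : robust v L U beta A gamma) :
  ~ consistent v L U beta best A 1%:E.
Proof.
case: hA => hfeas honl hcons.
pose e := if v is OCSmin then L else U.
pose w := if v is OCSmin then U else L.
pose p := (L + U) / 2.
have hp : L <= p <= U by rewrite /p; lra.
have he : L <= e <= U by rewrite /e; case: (v); lra.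
have hw : L <= w <= U by rewrite /w; case: (v); lra.
(* The second price makes the best price at least as good as [e]; being one of three prices in
   [L, U], it is no better. *)
have best_e c : L <= c <= U -> best (three_steps p e c) = e.
  move=> hc.
  have [//|[t ->] all_t] := hbest (three_steps p e c) (fun t => [:: p; e; c]`_t)
    (three_steps_valid v hL hp he hc).
  have := all_t (lift ord0 ord0).
  rewrite /e; case: (v) t all_t => -[[|[|[|//]]] i] /= _ h; lra.
(* The prediction [e] is correct whatever [c] is, so 1-consistency bounds the ratio on this instance
   by 1. *)
have optimal c x y z : L <= c <= U ->
    @feasible R (three_steps p e c) (decision3 x y z) ->
    match v with
    | OCSmin => objective v beta (A (three_steps p e c) e) <=
        @objective R v beta (three_steps p e c) (decision3 x y z)
    | OCSmax => @objective R v beta (three_steps p e c) (decision3 x y z) <=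
        objective v beta (A (three_steps p e c) e)
    end.
  move=> hc fx; have valid_c := three_steps_valid v hL hp he hc.
  apply: (@performance_ratio_le1_optimal _ _ _ _ _ _
    (if v is OCSmin then L else L - 2 * beta) (U + 2 * beta)) => //.
  - by case: (v) hbeta => //=; lra.
  - by move=> ? ?; exact: three_steps_objective_bounds.
  - exact: hfeas.
  - rewrite -lee_fin; apply: le_trans hcons; apply: ereal_sup_ubound.
    by exists (three_steps p e c, e) => //; split => //=; rewrite best_e.
(* At the first step both instances have shown only the price [p], under the same rates and
   prediction. *)
have first_eq : A (three_steps p e e) e ord0 = A (three_steps p e w) e ord0.
  apply: honl => //; [exact: three_steps_valid..|].
  by move=> -[[|//] i] _ y _.
have feas c : L <= c <= U -> feasible (A (three_steps p e c) e).
  by move=> hc; apply: hfeas => //; exact: three_steps_valid.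
have := feas _ he; have := feas _ hw.
have := optimal e (4^-1) (4^-1) (2^-1) he; have := optimal w (2^-1) (4^-1) (4^-1) hw.
move: (A _ _) (A _ _) first_eq => f g.
have [x1 [y1 [z1 ->]]] := decision3_surj f.
have [x2 [y2 [z2 ->]]] := decision3_surj g.
(* Index 1 stands for the instance with [c = w], index 2 for [c = e]; the common first decision is
   kept as [x2]. *)
rewrite /decision3 /= -!/(decision3 _ _ _) => <-.
rewrite !three_steps_objectiveE !three_steps_feasible.
have -> : `|2^-1 : R| + `|4^-1 - 2^-1| + `|4^-1 - 4^-1| + `|4^-1| = 1.
  by rewrite subrr normr0 (ler0_norm (_ : 4^-1 - 2^-1 <= 0)) ?ger0_norm; lra.
have -> : `|4^-1 : R| + `|4^-1 - 4^-1| + `|2^-1 - 4^-1| + `|2^-1| = 1.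
  by rewrite subrr normr0 !ger0_norm; lra.
move=> opt_w opt_e [_ y1_le _ sum1] [_ y2_le _ sum2].
have {opt_w} /= := opt_w ltac:(split; lra).
have {opt_e} /= := opt_e ltac:(split; lra).
have := three_steps_switching_ge1 y1_le sum1.
have := three_steps_switching_ge1 y2_le sum2.
set sw1 := `|x2| + `|y1 - x2| + _ + _; set sw2 := `|x2| + _ + _ + _ => sw2_ge1 sw1_ge1.
have beta0 : 0 < beta by case: (v) hbeta => /andP[].
have bsw1 : 0 <= beta * (sw1 - 1) by rewrite mulr_ge0; lra.
have bsw2 : 0 <= beta * (sw2 - 1) by rewrite mulr_ge0; lra.
have z1E : z1 = 1 - x2 - y1 by lra.
have z2E : z2 = 1 - x2 - y2 by lra.
(* In both variants, optimality for [c = w] reads (U - L) (1/2 - x2 + 2 (1/4 - y1)) + 2 beta (sw1 -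
   1) <= 0, and for [c = e] it reads (U - L) (x2 - 1/4) + 2 beta (sw2 - 1) <= 0. The signs of these
   products refute the first if x2 <= 1/4 and the second otherwise. *)
have x2_gt : x2 <= 4^-1 -> 0 < (U - L) * (4^-1 - y1 + 2^-1 - x2).
  by move=> ?; rewrite mulr_gt0; lra.
have y1_slack : 0 <= (U - L) * (4^-1 - y1) by rewrite mulr_ge0; lra.
have x2_lt : 4^-1 < x2 -> 0 < (U - L) * (x2 - 4^-1).
  by move=> ?; rewrite mulr_gt0; lra.
rewrite {}z1E {}z2E /p /e /w; clear -x2_gt x2_lt y1_slack bsw1 bsw2.
by have [/x2_gt|/x2_lt] := leP x2 4^-1; case: v; lra.
Qed.
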